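(* Let $H$ be a separable Hilbert space and $A:H\to H$ a surjective bounded linear operator which is real diagonalisable as $A=V^{-1}M_fV$, where $(\Omega,\mathcal{A},\mu)$ is a measure space, $f\in L^\infty_\mu(\Omega)$ is real-valued, $M_f:L^2_\mu(\Omega)\to L^2_\mu(\Omega)$ is multiplication by $f$, and $V:H\to L^2_\mu(\Omega)$ is an invertible bounded linear operator. Define $\mathcal{F}(x):=-\frac12\,(Vx,M_fVx)_{L^2_\mu(\Omega)}$ and $K:=V^{-1}V^{-\mathsf{T}}$, and let $d$ be the associated metric $$d(x_1,x_2)^2:=\inf_{\gamma\in\Gamma(x_1,x_2)}\int_0^1\sup_{\xi\in H}\big\langle \xi,2\dot\gamma(s)-K\xi\big\rangle_H\,\mathrm{d}s .$$ Then $\mathcal{F}$ is geodesically $\lambda$-convex with respect to $d$, with $$\lambda:=-\operatorname*{ess\,sup}_{\omega\in\Omega}f(\omega)\;c_V,\qquad c_V:=\begin{cases}\|V^{-1}\|^2\,\|V\|^2,&\text{if }\operatorname*{ess\,sup}_{\Omega}f\ge0,\\ \|V^{-1}\|^{-2}\,\|V\|^{-2},&\text{otherwise},\end{cases}$$ where $\|V\|$ and $\|V^{-1}\|$ are the operator norms in $L(H,L^2_\mu(\Omega))$ and $L(L^2_\mu(\Omega),H)$. If in addition the measure space $(\Omega,\mathcal{A},\mu)$ is finite and the spectrum satisfies $\sigma(A)\subset(-\infty,0]$, then $f\le0$ $\mu$-a.e., and hence $\lambda\ge0$.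
   Context: $V^{\mathsf{T}}:L^2_\mu(\Omega)\to H$ denotes the Hilbert-space adjoint of $V$ and $V^{-\mathsf{T}}$ the adjoint of $V^{-1}$ (equivalently the inverse of $V^{\mathsf{T}}$). $\Gamma(x_1,x_2)$ is the set of curves $\gamma\in C^1([0,1],H)$ with $\gamma(0)=x_1$, $\gamma(1)=x_2$. Geodesic $\lambda$-convexity of $\mathcal{F}$ w.r.t. $d$ means: for every constant-speed (arc-length parametrised) geodesic $\gamma:[0,1]\to H$ of $(H,d)$ and every $\theta\in[0,1]$, $\mathcal{F}(\gamma(\theta))\le(1-\theta)\mathcal{F}(\gamma(0))+\theta\mathcal{F}(\gamma(1))-\lambda\frac{\theta(1-\theta)}{2}d(\gamma(0),\gamma(1))^2$. *)

(* Defs.v *)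
From HB Require Import structures.
From mathcomp Require Import all_boot all_order all_algebra.
From mathcomp Require Import all_classical all_reals all_analysis ess_sup_inf.
Set Implicit Arguments. Unset Strict Implicit. Unset Printing Implicit Defensive.
Import Order.TTheory GRing.Theory Num.Theory.
Import numFieldNormedType.Exports.
Local Open Scope classical_set_scope.
Local Open Scope ring_scope.

Section Defs.
Context {R : realType}.

Definition is_inner_product (H : normedModType R) (ip : H -> H -> R) : Prop :=
  [/\ (forall x y, ip x y = ip y x),
      (forall a x y z, ip (a *: x + y) z = a * ip x z + ip y z) &
      (forall x, ip x x = `|x| ^+ 2)].

Definition separable (H : normedModType R) : Prop :=
  exists S : set H, countable S /\ closure S = setT.

Context {d : measure_display} {Omega : measurableType d}.
Variable mu : {measure set Omega -> \bar R}.

Definition L2 (g : Omega -> R) : Prop :=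
  measurable_fun setT g /\ (\int[mu]_w ((g w) ^+ 2)%:E < +oo)%E.

Definition L2ip (g h : Omega -> R) : R := fine (\int[mu]_w (g w * h w)%:E).
Definition L2norm (g : Omega -> R) : R := Num.sqrt (L2ip g g).

Definition Linfty (f : Omega -> R) : Prop :=
  measurable_fun setT f /\ (ess_sup mu (fun w => (`|f w|)%:E) < +oo)%E.

Definition esssup (f : Omega -> R) : R := fine (ess_sup mu (fun w => (f w)%:E)).

Definition inv_bounded_linear (H : normedModType R)
    (V : H -> Omega -> R) (Vinv : (Omega -> R) -> H) : Prop :=
  (forall x, L2 (V x)) /\
  (forall x y, V (x + y) = (V x \+ V y) %[ae mu]) /\
  (forall (a : R) x, V (a *: x) = (fun w => a * V x w) %[ae mu]) /\
  (exists C : R, forall x, L2norm (V x) <= C * `|x|) /\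
  (forall g h, L2 g -> L2 h -> g = h %[ae mu] -> Vinv g = Vinv h) /\
  (forall g h, L2 g -> L2 h -> Vinv (g \+ h) = Vinv g + Vinv h) /\
  (forall (a : R) g, L2 g -> Vinv (fun w => a * g w) = a *: Vinv g) /\
  (exists C : R, forall g, L2 g -> `|Vinv g| <= C * L2norm g) /\
  (forall x, Vinv (V x) = x) /\
  (forall g, L2 g -> V (Vinv g) = g %[ae mu]).

Definition is_adjoint_of_inv (H : normedModType R) (ip : H -> H -> R)
    (Vinv : (Omega -> R) -> H) (Vadj : H -> Omega -> R) : Prop :=
  forall xi, L2 (Vadj xi) /\ (forall g, L2 g -> L2ip (Vadj xi) g = ip xi (Vinv g)).

Definition opnormV (H : normedModType R) (V : H -> Omega -> R) : R :=
  sup [set L2norm (V x) | x in [set x : H | `|x| <= 1]].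
Definition opnormVinv (H : normedModType R) (Vinv : (Omega -> R) -> H) : R :=
  sup [set `|Vinv g| | g in [set g | L2 g /\ L2norm g <= 1]].

End Defs.

Section Metric.
Context {R : realType} {H : normedModType R}.
Variables (ip : H -> H -> R) (K : H -> H).

(* Gamma(x1,x2): C^1 curves [0,1] -> H from x1 to x2, represented as restrictions
   to [0,1] of C^1 maps R -> H *)
Definition Gamma (x1 x2 : H) : set (R -> H) :=
  [set gam | (forall s : R, derivable gam s 1) /\ continuous (derive1 gam) /\
             gam 0 = x1 /\ gam 1 = x2].

Definition action (gam : R -> H) : \bar R :=
  (\int[lebesgue_measure]_(s in `[0%R, 1%R])
     ereal_sup [set (ip xi (2 *: derive1 gam s - K xi))%:E | xi in [set: H]])%E.

Definition dist2 (x1 x2 : H) : \bar R :=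
  ereal_inf [set action gam | gam in Gamma x1 x2].

Definition dist (x1 x2 : H) : R := Num.sqrt (fine (dist2 x1 x2)).

Definition cs_geodesic (gam : R -> H) : Prop :=
  forall s t, 0 <= s <= 1 -> 0 <= t <= 1 ->
    dist (gam s) (gam t) = `|s - t| * dist (gam 0) (gam 1).

Definition geod_convex (F : H -> R) (lam : R) : Prop :=
  forall gam, cs_geodesic gam -> forall th, 0 <= th <= 1 ->
    F (gam th) <= (1 - th) * F (gam 0) + th * F (gam 1)
                  - lam * (th * (1 - th) / 2) * dist (gam 0) (gam 1) ^+ 2.

End Metric.

Definition real_spectrum {R : realType} {H : normedModType R} (A : H -> H) : set R :=
  [set l | ~ bijective (fun x => A x - l *: x)].

(* Main.v *)
(* Pulling the inner product of L^2 back along V gives a form B x y = (V x, V y)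
   equivalent to that of H, for which K is the Riesz map: <xi, y> = B (K xi) y.
   The supremum in the definition of d is therefore B v v with v = gamma'(s), so
   d(x, y)^2 = B (x - y) (x - y), and the geodesics are the segments.  Along a
   segment the quadratic function F(x) = - B (A x) x / 2 has the constant convexity
   defect - B (A u) u / 2, u = x - y, and B (A u) u <= ess sup f * B u u; the factor
   c_V only weakens this bound, because |V^-1| |V| >= 1.
   For the second part, if l = ess sup f > 0 were not in the spectrum, then (A - l)^-1
   would be B-symmetric, hence bounded by the Hellinger-Toeplitz theorem; but the
   indicators of {f > l - eps} are approximate eigenvectors for l. *)
Require Import Defs.
From HB Require Import structures.
From mathcomp Require Import all_boot all_order all_algebra.
From mathcomp Require Import all_classical all_reals all_analysis ess_sup_inf.
From mathcomp Require Import measurable_realfun.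
From mathcomp Require Import ring lra.
Import Order.TTheory GRing.Theory Num.Theory.
Import numFieldNormedType.Exports.
Local Open Scope classical_set_scope.
Local Open Scope ring_scope.

(** * Symmetric positive semidefinite forms *)

Definition psd_form {R : realType} {E : lmodType R} (B : E -> E -> R) : Prop :=
  [/\ forall x y, B x y = B y x,
      forall a x y z, B (a *: x + y) z = a * B x z + B y z &
      forall x, 0 <= B x x].

Section PsdForm.
Context {R : realType} {E : lmodType R} {B : E -> E -> R}.
Context (BP : psd_form B).

Lemma formC x y : B x y = B y x. Proof. by case: BP. Qed.

Lemma form_ge0 x : 0 <= B x x. Proof. by case: BP. Qed.

Lemma formPl a x y z : B (a *: x + y) z = a * B x z + B y z.
Proof. by case: BP. Qed.

Lemma formDl x y z : B (x + y) z = B x z + B y z.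
Proof. by rewrite -{1}[x]scale1r formPl mul1r. Qed.

Lemma form0l z : B 0 z = 0.
Proof. by apply: (addrI (B 0 z)); rewrite -formDl !addr0. Qed.

Lemma formZl a x z : B (a *: x) z = a * B x z.
Proof. by rewrite -[a *: x]addr0 formPl form0l addr0. Qed.

Lemma formNl x z : B (- x) z = - B x z.
Proof. by rewrite -scaleN1r formZl mulN1r. Qed.

Lemma formDr x y z : B z (x + y) = B z x + B z y.
Proof. by rewrite ![B z _]formC formDl. Qed.

Lemma formZr a x z : B z (a *: x) = a * B z x.
Proof. by rewrite ![B z _]formC formZl. Qed.

Lemma formNr x z : B z (- x) = - B z x.
Proof. by rewrite ![B z _]formC formNl. Qed.

Definition formE := (formDl, formDr, formNl, formNr, formZl, formZr).

Lemma form_CS x y : B x y ^+ 2 <= B x x * B y y.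
Proof.
have y0 := form_ge0 y.
have [y_gt0|y_le0] := ltP 0 (B y y).
  (* Expanding the form on this vector gives [B y y] times the Cauchy-Schwarz defect. *)
  have := form_ge0 (B y y *: x - B x y *: y); rewrite !formE (formC y x).
  rewrite (_ : _ + _ = B y y * (B x x * B y y - B x y ^+ 2)); last by ring.
  by rewrite pmulr_rge0// subr_ge0.
have /eqP yy0 : B y y == 0 by rewrite eq_le y_le0 y0.
suff -> : B x y = 0 by rewrite expr0n yy0 mulr0.
apply: contrapT => /eqP xy0.
(* Since [B y y = 0], the form at [x - t y] is [B x x - 2 t B x y], affine in [t]; this [t] makes it
   equal to [-1]. *)
have := form_ge0 (x - ((B x x + 1) / (2 * B x y)) *: y).
rewrite !formE (formC y x) yy0 => h.
suff : 0 <= - 1 :> R by rewrite oppr_ge0 lt_geF.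
apply: le_trans h _; rewrite le_eqVlt; apply/orP; left; apply/eqP.
by field; rewrite xy0.
Qed.

(** A convex quadratic lies above its tangent at [x]. Being linear in [y], this minorant can be
    integrated along a curve. *)
Lemma form_tangent x y : 2 * B x y - B x x <= B y y.
Proof. by have := form_ge0 (x - y); rewrite !formE (formC y x); lra. Qed.

End PsdForm.

Lemma inner_product_psd {R : realType} {H : normedModType R} {ip : H -> H -> R} :
  is_inner_product ip -> psd_form ip.
Proof. by case=> ipC ipl ipn; split=> // x; rewrite ipn exprn_ge0. Qed.

(** * Forms equivalent to the norm: continuity and the Riesz map *)

Section EquivalentForm.
Context {R : realType} {H : completeNormedModType R}.
Context {ip B : H -> H -> R} {K : H -> H} {C1 C2 : R}.
Context (ipP : is_inner_product ip) (BP : psd_form B).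
Context (C1_gt0 : 0 < C1) (C2_gt0 : 0 < C2).
Context (B_le : forall x, B x x <= C1 * `|x| ^+ 2).
Context (B_ge : forall x, `|x| ^+ 2 <= C2 * B x x).
Context (KP : forall x y, ip x y = B (K x) y).

Let ipS := inner_product_psd ipP.

Lemma form_eq0 x : B x x = 0 -> x = 0.
Proof.
move=> x0; apply/eqP; rewrite -normr_eq0 -sqrf_eq0 eq_le sqr_ge0 andbT.
by rewrite (le_trans (B_ge x))// x0 mulr0.
Qed.

Lemma form_bounded x y : `|B x y| <= C1 * `|x| * `|y|.
Proof.
rewrite -(@ler_pXn2r _ 2)// ?nnegrE ?mulr_ge0 ?(ltW C1_gt0)//.
rewrite real_normK ?num_real// (le_trans (form_CS BP x y))//.
by rewrite (_ : _ ^+ 2 = (C1 * `|x| ^+ 2) * (C1 * `|y| ^+ 2)); [rewrite ler_pM ?(form_ge0 BP)|ring].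
Qed.

Lemma form_cvg {T} {F : set_system T} {FF : Filter F} x (g : T -> H) l :
  g @ F --> l -> B x (g t) @[t --> F] --> B x l.
Proof.
move=> gl; apply/cvgrPdist_le => e e0.
have M0 : 0 < C1 * `|x| + 1 by rewrite ltr_wpDl ?mulr_ge0 ?(ltW C1_gt0).
have /cvgrPdist_le /(_ (e / (C1 * `|x| + 1))) := gl.
rewrite divr_gt0// => /(_ isT); apply: filterS => t lt.
rewrite -(formNr BP) -(formDr BP) (le_trans (form_bounded _ _))//.
rewrite ler_pdivlMr// in lt; rewrite (le_trans _ lt)// mulrC ler_wpM2l//.
by rewrite lerDl.
Qed.

Lemma form_diag_continuous : continuous (fun x => B x x).
Proof.
move=> x; rewrite /continuous_at.
(* Expansion around [x]: a quadratic remainder, squeezed by [C1 |y - x|^2], plus a part affine in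
   [y]. *)
have -> : (fun y => B y y) = (fun y => B (y - x) (y - x) + (B x y + B x y - B x x)).
  by apply/funext => y; rewrite !(formE BP) (formC BP y x); ring.
rewrite [X in _ --> X](_ : _ = 0 + (B x x + B x x - B x x)); last by ring.
apply: cvgD; last first.
  by apply: cvgB; [apply: cvgD; apply: form_cvg|]; [exact: cvg_id..|exact: cvg_cst].
apply: (@squeeze_cvgr _ _ _ _ (fun=> 0) (fun y => C1 * `|y - x| ^+ 2)).
- by near=> y; rewrite (form_ge0 BP) B_le.
- exact: cvg_cst.
- have yx0 : `|y - x| @[y --> x] --> (0 : R).
    by rewrite -(@normr0 _ H) -(subrr x); apply: cvg_norm; apply: cvgB; [exact: cvg_id|exact: cvg_cst].
  have h : (C1 * (`|y - x| * `|y - x|)) @[y --> x] --> C1 * (0 * 0).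
    by apply: cvgM; [exact: cvg_cst|exact: cvgM].
  by rewrite !mulr0 in h; exact: h.
Unshelve. all: by end_near. Qed.

(* [x |-> x - tau (K x - v)] is a contraction for [tau = 1 / C2]: with
   [q = ip x (K x)], one has [|K x|^2 <= C2 q] and [|x|^2 <= C1 q]. *)
Lemma form_riesz v : exists x, K x = v.
Proof.
(* Additivity of [K] comes from [KP]: the defect [w] is [B]-orthogonal to every vector, hence to
   itself. *)
have KB x y : K x - K y = K (x - y).
  apply/eqP; rewrite -subr_eq0; apply/eqP; apply: form_eq0.
  set w := _ - K _; rewrite {1}/w !(formDl BP) !(formNl BP) -!KP.
  by rewrite !(formE ipS); ring.
have qE x : ip x (K x) = B (K x) (K x) by rewrite KP.
have K_le x : `|K x| ^+ 2 <= C2 * ip x (K x) by rewrite qE.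
(* Cauchy-Schwarz: [|x|^4 = B (K x) x ^ 2 <= q B x x <= q C1 |x|^2] with [q = ip x (K x)]; then
   [|x|^2] is cancelled. *)
have K_ge x : `|x| ^+ 2 <= C1 * ip x (K x).
  have [->|x0] := eqVneq x 0; first by rewrite (form0l ipS) normr0 expr0n mulr0.
  have x2 : 0 < `|x| ^+ 2 by rewrite exprn_gt0 ?normr_gt0.
  rewrite -(ler_pM2l x2); have [_ _ ipn] := ipP.
  rewrite -{1 2}ipn -expr2 KP (le_trans (form_CS BP _ _))// -qE mulrC.
  rewrite mulrA [leRHS](_ : _ = (C1 * `|x| ^+ 2) * ip x (K x)); last by ring.
  by rewrite ler_wpM2r// qE (form_ge0 BP).
(* The estimates give [|x - tau K x|^2 <= |x|^2 - tau q <= (1 - 1 / (C1 C2)) |x|^2]. Replacing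
   [C1 C2] by [C1 C2 + 1] in the denominator weakens this factor to a [k] that visibly lies in
   [[0, 1)]. *)
pose k := C1 * C2 / (C1 * C2 + 1); pose tau := C2^-1.
have C12 : 0 < C1 * C2 by rewrite mulr_gt0.
have k0 : 0 <= k by rewrite divr_ge0 ?addr_ge0 ?ltW.
have k1 : k < 1 by rewrite ltr_pdivrMr ?addr_gt0// mul1r ltrDl.
have key x : `|x - tau *: K x| ^+ 2 <= k * `|x| ^+ 2.
  have [_ _ ipn] := ipP; have h1 := K_le x; have h2 := K_ge x.
  rewrite -[leLHS]ipn !(formE ipS) !ipn (formC ipS (K x) x).
  have h3 : tau * (tau * `|K x| ^+ 2) <= tau * ip x (K x).
    by rewrite ler_pM2l ?invr_gt0// /tau -ler_pdivlMl ?invr_gt0// invrK.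
  have h4 : (1 - k) * `|x| ^+ 2 <= tau * ip x (K x).
    have -> : 1 - k = (C1 * C2 + 1)^-1 by rewrite /k; field; lra.
    rewrite -ler_pdivlMl ?invr_gt0 ?addr_gt0// invrK (le_trans h2)//.
    rewrite mulrA ler_wpM2r ?qE ?(form_ge0 BP)// /tau mulrDl mul1r mulfK ?gt_eqF//.
    by rewrite lerDl invr_ge0 ltW.
  lra.
pose T x := x - tau *: (K x - v).
have TT : {homo T : x / [set: H] x >-> [set: H] x} by [].
have TC : is_contraction (mkfun TT).
  (* The bound [key] is on squared norms, so the Lipschitz constant is the square root of [k]. *)
  exists (NngNum (sqrtr_ge0 k)); split => /=.
    by rewrite -sqrtr1 ltr_sqrt.
  move=> [x y] _ /=; rewrite /mkfun /T opprD addrACA -opprD -scalerBr.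
  have -> : K x - v - (K y - v) = K (x - y) by rewrite opprB addrA subrK KB.
  rewrite -(@ler_pXn2r _ 2)// ?nnegrE ?mulr_ge0//.
  by rewrite exprMn sqr_sqrtr.
have [|x _] := banach_fixed_point TC closedT; first by exists 0.
rewrite /mkfun /T => /eqP; rewrite -subr_eq0 opprB addrC subrK scaler_eq0.
rewrite invr_eq0 (gt_eqF C2_gt0)/= subr_eq0 => /eqP Kx; by exists x.
Qed.

(** * Action, distance and geodesics *)

Lemma quadratic_sup v :
  ereal_sup [set (ip xi (2 *: v - K xi))%:E | xi in [set: H]] = (B v v)%:E.
Proof.
apply/eqP; rewrite eq_le; apply/andP; split.
  (* By [KP] and completion of the square, the bracket is [B v v - B (v - K xi) (v - K xi)];
     equality holds where [K xi = v], which [form_riesz] solves. *)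
  apply: ge_ereal_sup => _ [xi _ <-]; rewrite lee_fin.
  have := form_ge0 BP (v - K xi); rewrite KP !(formE BP) (formC BP (K xi) v); lra.
have [x Kx] := form_riesz v; apply: ereal_sup_ubound; exists x => //.
by rewrite KP Kx !(formE BP); congr EFin; ring.
Qed.

Lemma action_form gam : action ip K gam =
  (\int[lebesgue_measure]_(s in `[0%R, 1%R]) (B (derive1 gam s) (derive1 gam s))%:E)%E.
Proof. by apply: eq_integral => s _; rewrite quadratic_sup. Qed.

Lemma is_derive_form x (gam : R -> H) s : derivable gam s 1 ->
  is_derive s 1 (fun t => B x (gam t)) (B x (derive1 gam s)).
Proof.
move=> dg; rewrite derive1E.
have cv : (fun h : R => h^-1 *: (((fun t => B x (gam t)) \o shift s) (h *: 1) -
    B x (gam s))) @ 0^' --> B x ('D_1 gam s).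
  under eq_fun do rewrite /= -(formNr BP) -(formDr BP) [_ *: B _ _]mulrC mulrC -(formZr BP).
  exact: form_cvg.
by apply: DeriveDef; [apply: (cvgP _ cv)|exact: (cvg_lim _ cv)].
Qed.

(** The integrand is bounded below by its tangent at the constant velocity [a = x2 - x1]. That
    minorant [g] has the primitive [G], so its integral depends on the endpoints only:
    [2 B a a - B a a]. *)
Lemma action_ge x1 x2 gam : Gamma x1 x2 gam ->
  ((B (x2 - x1) (x2 - x1))%:E <= action ip K gam)%E.
Proof.
move=> [dg [cg [g0 g1]]]; rewrite action_form; set a := x2 - x1.
pose g s := B (2 *: a) (derive1 gam s) - B a a.
pose G s := B (2 *: a) (gam s) - B a a * s.
have cdg : continuous (fun s => B (derive1 gam s) (derive1 gam s)).
  move=> s; apply: (@continuous_comp _ _ _ (derive1 gam) (fun x => B x x)).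
    exact: cg.
  exact: form_diag_continuous.
have cont_g : continuous g.
  by move=> s; apply: cvgB; [apply: form_cvg; exact: cg|exact: cvg_cst].
have dG (s : R) : is_derive s 1 G (g s).
  have dB := is_derive_form (2 *: a) _ _ (dg s).
  by apply: is_derive_eq; rewrite /g /GRing.scale/= mulr1.
have GE : (\int[lebesgue_measure]_(s in `[0%R, 1%R]) (g s)%:E = (B a a)%:E)%E.
  rewrite (@continuous_FTC2 _ g G)//.
  - rewrite /G g0 g1 -EFinB; congr EFin; rewrite /a !(formE BP); ring.
  - exact: continuous_subspaceT.
  - have cG s : {for s, continuous G}.
      by apply: differentiable_continuous; apply/derivable1_diffP; exact: ex_derive.
    split=> [s _||]; first exact: ex_derive.
    - exact/cvg_at_right_filter/cG.
    - exact/cvg_at_left_filter/cG.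
  - by move=> s _; rewrite derive1E; exact: derive_val.
rewrite -GE; apply: le_integral => //.
- by apply: continuous_compact_integrable; [exact: segment_compact|exact: continuous_subspaceT].
- by apply: continuous_compact_integrable; [exact: segment_compact|exact: continuous_subspaceT].
- move=> s _; rewrite lee_fin /g (formZl BP); exact: (form_tangent BP).
Qed.

Lemma dist2_form x1 x2 : dist2 ip K x1 x2 = (B (x2 - x1) (x2 - x1))%:E.
Proof.
apply/eqP; rewrite eq_le; apply/andP; split; last first.
  by apply: le_ereal_inf_tmp => _ [gam Ggam <-]; exact: action_ge.
(* The segment has constant velocity [x2 - x1] and attains the lower bound. *)
apply: ereal_inf_lbound; pose gam (s : R) := x1 + s *: (x2 - x1).
have dgam (s : R) : is_derive s 1 gam (x2 - x1).
  have cv : (fun h : R => h^-1 *: ((gam \o shift s) (h *: 1) - gam s)) @ 0^' --> x2 - x1.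
    apply: cvg_near_cst; near=> h.
    have h0 : h != 0 by near: h; exact: nbhs_dnbhs_neq.
    rewrite /gam /= [h *: 1]mulr1 scalerDl addrCA addrK scalerA mulVf// scale1r.
    by [].
  by apply: DeriveDef; [apply: (cvgP _ cv)|exact: (cvg_lim _ cv)].
have dgamE : derive1 gam = cst (x2 - x1).
  by apply/funext => s; rewrite derive1E derive_val.
exists gam.
  split; first by move=> s; exact: ex_derive.
  split; first by rewrite dgamE; exact: cst_continuous.
  by rewrite /gam scale0r addr0 scale1r addrC subrK.
rewrite action_form (eq_integral (cst (B (x2 - x1) (x2 - x1))%:E)) => [|s _]; last first.
  by rewrite dgamE.
by rewrite integral_cst//= lebesgue_measure_itv/= lte_fin ltr01 oppr0 adde0 mule1.
Unshelve. all: by end_near. Qed.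

Lemma dist_form x1 x2 : dist ip K x1 x2 = Num.sqrt (B (x1 - x2) (x1 - x2)).
Proof. by rewrite /dist dist2_form/= -opprB !(formNl BP, formNr BP) opprK. Qed.

Lemma dist_form_sq x1 x2 : dist ip K x1 x2 ^+ 2 = B (x1 - x2) (x1 - x2).
Proof. by rewrite dist_form sqr_sqrtr ?(form_ge0 BP). Qed.

(* Equality in the triangle inequality: a point splitting [0, 1] in the ratio
   [th : 1 - th] of distances lies on the segment. *)
Lemma cs_geodesic_segment gam th : cs_geodesic ip K gam -> 0 <= th <= 1 ->
  gam th = (1 - th) *: gam 0 + th *: gam 1.
Proof.
move=> geo th01; have /andP[th0 th1] := th01.
have i01 : 0 <= (0 : R) <= 1 by rewrite lexx ler01.
have i11 : 0 <= (1 : R) <= 1 by rewrite lexx ler01.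
have h0 := congr1 (fun x => x ^+ 2) (geo _ _ th01 i01).
have h1 := congr1 (fun x => x ^+ 2) (geo _ _ i11 th01).
move: h0 h1; rewrite /= !exprMn !real_normK ?num_real// !dist_form_sq.
set p := gam th; set x := gam 0; set y := gam 1 => h0 h1.
apply/eqP; rewrite -subr_eq0; apply/eqP; apply: form_eq0.
have e : x - y = - ((p - x) + (y - p)) by rewrite opprD !opprB addrA subrK.
move: h0 h1; rewrite e.
(* With [u = p - x], [w = y - p] and [D = B (u + w) (u + w)], the hypotheses read [B u u = th^2 D]
   and [B w w = (1 - th)^2 D]. Expanding [D] forces [B u w = th (1 - th) D], and then the form
   vanishes on [(1 - th) u - th w]. *)
have -> : p - ((1 - th) *: x + th *: y) = (1 - th) *: (p - x) - th *: (y - p).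
  by rewrite !scalerBr opprB addrACA -scalerDl subrK scale1r -opprD.
move: (p - x) (y - p) => u w; rewrite !(formE BP) (formC BP w u).
rewrite !subr0; nra.
Qed.

(* Hellinger-Toeplitz: an everywhere defined symmetric map is bounded, by uniform
   boundedness of the functionals [x |-> B x (T y)] for [B y y <= 1]. *)
Lemma symmetric_bounded (T : H -> H) : (forall x y, B (T x) y = B x (T y)) ->
  exists C, forall x, B (T x) (T x) <= C * B x x.
Proof.
move=> Tsym.
(* Homogeneity of [T] is a consequence of symmetry and definiteness. *)
have TZ a x : T (a *: x) = a *: T x.
  apply/eqP; rewrite -subr_eq0; apply/eqP; apply: form_eq0.
  set w := _ - _; rewrite {1}/w (formDl BP) (formNl BP) (formZl BP) !Tsym.
  by rewrite (formZl BP) subrr.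
pose Phi : set (H -> R^o) := [set phi | exists2 y, B y y <= 1 & phi = B ^~ (T y)].
have Phi_lin phi : Phi phi -> bounded_fun_norm phi /\ linear phi.
  move=> [y _ ->]; split=> [r|a u v]; last by rewrite (formPl BP).
  exists (C1 * r * `|T y|) => x xr; rewrite (le_trans (form_bounded _ _))//.
  by rewrite ler_wpM2r// ler_wpM2l// ltW.
have Phi_pt : pointwise_bounded Phi.
  move=> x; exists (1 + B (T x) (T x)) => _ [y y1 ->].
  (* For fixed [x], symmetry turns the functional into [B (T x) y], which Cauchy-Schwarz bounds
     uniformly in [y]; [2 |b| <= 1 + b^2] avoids a square root. *)
  rewrite /= -Tsym; have := form_CS BP (T x) y; have := form_ge0 BP (T x).
  set b := B (T x) y; set n := B (T x) (T x) => n0 hb.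
  have {hb} : `|b| ^+ 2 <= n by rewrite real_normK ?num_real// (le_trans hb)// ler_piMr.
  by move=> hb; have := sqr_ge0 (`|b| - 1); nra.
have [M bM] := Banach_Steinhauss Phi_lin Phi_pt 1.
have bT y : B y y <= 1 -> B (T y) (T y) <= C2 * M ^+ 2.
  move=> y1; have [Ty0|Ty0] := eqVneq (T y) 0.
    by rewrite Ty0 (form0l BP) mulr_ge0 ?sqr_ge0 ?ltW.
  have Bgt0 : 0 < B (T y) (T y).
    rewrite lt_neqAle (form_ge0 BP) andbT eq_sym; apply: contra_neq Ty0.
    exact: form_eq0.
  have n0 : 0 < `|T y| by rewrite normr_gt0.
  (* Testing on the normalised [T y] gives [B (T y) (T y) <= M |T y|]; squaring and using [B_ge]
     cancels one factor. *)
  have := bM _ (ex_intro2 _ _ y y1 erefl) (`|T y|^-1 *: T y).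
  rewrite normrZ normfV normr_id mulVf ?gt_eqF// => /(_ (lexx _)).
  rewrite [X in `|X|](formZl BP) normrM normfV normr_id (ger0_norm (ltW Bgt0)).
  rewrite ler_pdivrMl// mulrC => le1; have le2 := B_ge (T y).
  rewrite -(ler_pM2r Bgt0) -expr2.
  have le3 : B (T y) (T y) ^+ 2 <= (M * `|T y|) ^+ 2.
    by rewrite ler_pXn2r ?nnegrE// ?(ltW Bgt0)// (le_trans _ le1)// ltW.
  rewrite (le_trans le3)// exprMn [C2 * _]mulrC -[leRHS]mulrA.
  by rewrite ler_wpM2l ?sqr_ge0.
exists (C2 * M ^+ 2) => y; have [->|y0] := eqVneq y 0.
  by rewrite -(scale0r 0) TZ !(formE BP) !mul0r mulr0.
have Bgt0 : 0 < B y y.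
  rewrite lt_neqAle (form_ge0 BP) andbT eq_sym; apply: contra_neq y0.
  exact: form_eq0.
set s := Num.sqrt (B y y); have s0 : 0 < s by rewrite sqrtr_gt0.
have s2 : s ^+ 2 = B y y by rewrite sqr_sqrtr// ltW.
have -> : B (T y) (T y) = s ^+ 2 * B (T (s^-1 *: y)) (T (s^-1 *: y)).
  by rewrite TZ !(formE BP); field; rewrite gt_eqF.
rewrite s2 mulrC ler_wpM2r ?(ltW Bgt0)//; apply: bT.
by rewrite !(formE BP) -s2 le_eqVlt; apply/orP; left; apply/eqP; field; rewrite gt_eqF.
Qed.

End EquivalentForm.

(** * Square-integrable functions and their inner product *)

Section SquareIntegrable.
#[local] Set Implicit Arguments.
#[local] Unset Strict Implicit.
Context {R : realType} {d : measure_display} {Omega : measurableType d}.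
Context {mu : {measure set Omega -> \bar R}}.
Implicit Types f g h k : Omega -> R.

Lemma L2_integrable_sqr g : L2 mu g -> mu.-integrable setT (EFin \o (fun w => g w ^+ 2)).
Proof.
move=> [mg ig]; apply/integrableP; split.
  by apply/measurable_EFinP; exact: measurable_funX.
by under eq_integral do rewrite /= ger0_norm ?sqr_ge0//.
Qed.

Lemma L2_of_integrable_sqr g : measurable_fun setT g ->
  mu.-integrable setT (EFin \o (fun w => g w ^+ 2)) -> L2 mu g.
Proof.
move=> mg /integrableP[_ ig]; split=> //.
by move: ig; under eq_integral do rewrite /= ger0_norm ?sqr_ge0//.
Qed.

Lemma L2_integrable_mul g h : L2 mu g -> L2 mu h ->
  mu.-integrable setT (EFin \o (fun w => g w * h w)).
Proof.
move=> Lg Lh; have ig := L2_integrable_sqr Lg; have ih := L2_integrable_sqr Lh.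
apply: le_integrable (integrableD measurableT ig ih) => //.
  by apply/measurable_EFinP/measurable_funM; [case: Lg|case: Lh].
move=> w _ /=; rewrite lee_fin normrM [leRHS]ger0_norm ?addr_ge0 ?sqr_ge0//.
rewrite -(real_normK (num_real (g w))) -(real_normK (num_real (h w))).
have := sqr_ge0 (`|g w| - `|h w|); have := normr_ge0 (g w); have := normr_ge0 (h w); nra.
Qed.

Lemma L2D g h : L2 mu g -> L2 mu h -> L2 mu (g \+ h).
Proof.
move=> Lg Lh; have ig := L2_integrable_sqr Lg; have ih := L2_integrable_sqr Lh.
have mgh : measurable_fun setT (g \+ h) by apply: measurable_funD; [case: Lg|case: Lh].
apply: L2_of_integrable_sqr => //.
apply: le_integrable (integrableZl measurableT 2 (integrableD measurableT ig ih)) => //.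
  by apply/measurable_EFinP/measurable_funX.
move=> w _ /=; rewrite lee_fin [leLHS]ger0_norm ?sqr_ge0// [leRHS]ger0_norm.
  by have := sqr_ge0 (g w - h w); lra.
by rewrite mulr_ge0// addr_ge0 ?sqr_ge0.
Qed.

Lemma L2Z a g : L2 mu g -> L2 mu (fun w => a * g w).
Proof.
move=> Lg; have ig := L2_integrable_sqr Lg.
have mag : measurable_fun setT (fun w => a * g w) by apply: measurable_funM => //; case: Lg.
apply: L2_of_integrable_sqr => //.
apply: eq_integrable (integrableZl measurableT (a ^+ 2) ig) => // w _ /=.
by rewrite exprMn EFinM.
Qed.

Lemma L2_ae_bounded_mul f (M : R) g : measurable_fun setT f ->
  {ae mu, forall w, `|f w| <= M} -> L2 mu g -> L2 mu (fun w => f w * g w).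
Proof.
move=> mf fM Lg; have ig := L2_integrable_sqr Lg; have [mg _] := Lg.
have mfg : measurable_fun setT (fun w => f w * g w) by exact: measurable_funM.
split=> //; have /integrableP[_] := integrableZl measurableT (M ^+ 2) ig.
apply: le_lt_trans; apply: ae_ge0_le_integral => //.
- by move=> w _; rewrite lee_fin sqr_ge0.
- by apply/measurable_EFinP/measurable_funX.
- apply/measurable_EFinP; apply: measurableT_comp => //.
  by apply: measurable_funM => //; exact: measurable_funX.
- apply: filterS fM => w fM _ /=.
  rewrite lee_fin [leRHS]ger0_norm; last by rewrite mulr_ge0 ?sqr_ge0.
  rewrite exprMn ler_wpM2r ?sqr_ge0//.
  by rewrite -(real_normK (num_real (f w))) ler_pXn2r ?nnegrE//= (le_trans _ fM).
Qed.

Lemma L2ipC g h : L2ip mu g h = L2ip mu h g.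
Proof. by rewrite /L2ip; under eq_integral do rewrite mulrC. Qed.

Lemma L2ipP a g h k : L2 mu g -> L2 mu h -> L2 mu k ->
  L2ip mu (fun w => a * g w + h w) k = a * L2ip mu g k + L2ip mu h k.
Proof.
move=> Lg Lh Lk; have igk := L2_integrable_mul Lg Lk; have ihk := L2_integrable_mul Lh Lk.
have iagk := L2_integrable_mul (L2Z a Lg) Lk.
transitivity (\int[mu]_w (a * (g w * k w) + h w * k w))%R.
  by apply: eq_Rintegral => w _; ring.
rewrite RintegralD//; last by apply: eq_integrable iagk => // w _ /=; rewrite mulrA.
by rewrite RintegralZl.
Qed.

Lemma L2ipZ a g h : L2 mu g -> L2 mu h ->
  L2ip mu (fun w => a * g w) h = a * L2ip mu g h.
Proof.
move=> Lg Lh; rewrite /L2ip -[RHS]RintegralZl//; last exact: L2_integrable_mul.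
by apply: eq_Rintegral => w _; ring.
Qed.

Lemma L2ip_ge0 g : 0 <= L2ip mu g g.
Proof. by apply: fine_ge0; apply: integral_ge0 => w _; rewrite lee_fin -expr2 sqr_ge0. Qed.

Lemma L2norm_sq g : L2norm mu g ^+ 2 = L2ip mu g g.
Proof. by rewrite /L2norm sqr_sqrtr ?L2ip_ge0. Qed.

Lemma L2ip_ae g g' h h' : L2 mu g -> L2 mu g' -> L2 mu h -> L2 mu h' ->
  g = g' %[ae mu] -> h = h' %[ae mu] -> L2ip mu g h = L2ip mu g' h'.
Proof.
move=> [mg _] [mg' _] [mh _] [mh' _] gg' hh'; congr fine; apply: ae_eq_integral => //.
- by apply/measurable_EFinP/measurable_funM.
- by apply/measurable_EFinP/measurable_funM.
- by apply: filterS2 gg' hh' => w /= gg' hh' Dw; rewrite gg' ?hh'.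
Qed.

Lemma L2ip_mul_le f (M : R) g : measurable_fun setT f -> L2 mu g -> L2 mu (fun w => f w * g w) ->
  {ae mu, forall w, f w <= M} ->
  L2ip mu (fun w => f w * g w) g <= M * L2ip mu g g.
Proof.
move=> mf Lg Lfg fM; have [mg _] := Lg.
have ig := L2_integrable_mul Lg Lg; have ifg := L2_integrable_mul Lfg Lg.
rewrite -subr_ge0 /L2ip -[X in X - _]RintegralZl// -RintegralB//; last first.
  by apply: eq_integrable (integrableZl measurableT M ig).
(* [M - f] is nonnegative only almost everywhere; the absolute value makes the integrand nonnegative
   at every point without changing the integral. *)
rewrite [leRHS](_ : _ = (\int[mu]_w (`|M - f w| * (g w * g w)))%R).
  by apply: Rintegral_ge0 => w _; rewrite mulr_ge0// -expr2 sqr_ge0.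
congr fine; apply: ae_eq_integral => //.
- apply/measurable_EFinP; apply: measurable_funB; repeat apply: measurable_funM => //.
- apply/measurable_EFinP; apply: measurable_funM; last exact: measurable_funM.
  by apply: measurableT_comp => //; exact: measurable_funB.
- apply: filterS fM => w fM _; rewrite ger0_norm ?subr_ge0//; congr EFin; ring.
Qed.

End SquareIntegrable.

(** * Convexity of the quadratic functional along geodesics *)

Lemma cs_geodesic_form_convex {R : realType} {H : completeNormedModType R}
    {ip B : H -> H -> R} {K A : H -> H} {C1 C2 : R} (lam : R) :
    is_inner_product ip -> psd_form B -> 0 < C1 -> 0 < C2 ->
    (forall x, B x x <= C1 * `|x| ^+ 2) -> (forall x, `|x| ^+ 2 <= C2 * B x x) ->
    (forall x y, ip x y = B (K x) y) -> (forall x y, B (A x) y = B x (A y)) ->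
    (forall x, B (A x) x <= - lam * B x x) ->
  geod_convex ip K (fun x => - (1 / 2) * B x (A x)) lam.
Proof.
move=> ipP BP C1_gt0 C2_gt0 B_le B_ge KP AS A_le gam geo th th01.
rewrite (cs_geodesic_segment ipP BP C1_gt0 C2_gt0 B_le B_ge KP _ _ geo th01).
rewrite (dist_form_sq ipP BP C1_gt0 C2_gt0 B_le B_ge KP).
move: (gam 0) (gam 1) => x y.
(* Linearity of [A], read through [B], follows from its symmetry. *)
have ADl u v w : B (A (u + v)) w = B (A u) w + B (A v) w by rewrite !AS (formDl BP).
have AZl a u w : B (A (a *: u)) w = a * B (A u) w by rewrite !AS (formZl BP).
have ANl u w : B (A (- u)) w = - B (A u) w by rewrite !AS (formNl BP).
have := A_le (x - y); rewrite -!AS !(ADl, AZl, ANl, formE BP) (formC BP y x).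
have -> : B (A y) x = B (A x) y by rewrite AS (formC BP).
have /andP[th0 th1] := th01.
have {th0 th1} : 0 <= th * (1 - th) by rewrite mulr_ge0// subr_ge0.
move: (B _ _) (B _ _) (B _ _) (B _ _) (B _ _) (B _ _) => a b c e g h t0 le1.
have := ler_wpM2l t0 le1; lra.
Qed.

(** * The form pulled back from [L^2] along [V] *)

Section Diagonalisable.
#[local] Set Implicit Arguments.
#[local] Unset Strict Implicit.
Context {R : realType} {H : completeNormedModType R} {ip : H -> H -> R}.
Context {d : measure_display} {Omega : measurableType d}.
Context {mu : {measure set Omega -> \bar R}} {f : Omega -> R}.
Context {V : H -> Omega -> R} {Vinv : (Omega -> R) -> H}.
Context {VinvT : H -> Omega -> R} {A : H -> H}.
Context (ipP : is_inner_product ip) (fP : Linfty mu f).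
Context (VP : inv_bounded_linear mu V Vinv).
Context (VinvTP : is_adjoint_of_inv mu ip Vinv VinvT).
Context (AP : forall x, A x = Vinv (fun w => f w * V x w)).

Let B x y := L2ip mu (V x) (V y).

Lemma V_L2 x : L2 mu (V x). Proof. by case: VP. Qed.

Lemma VinvK g : L2 mu g -> V (Vinv g) = g %[ae mu].
Proof. by case: VP => _ [_ [_ [_ [_ [_ [_ [_ [_ h]]]]]]]]; exact: h. Qed.

Lemma VK x : Vinv (V x) = x.
Proof. by case: VP => _ [_ [_ [_ [_ [_ [_ [_ [h _]]]]]]]]. Qed.

(** [V] is linear only up to null sets, which [L2ip] does not see. *)
Lemma pullback_psd : psd_form B.
Proof.
split=> [x y|a x y z|x]; [exact: L2ipC| |exact: L2ip_ge0].
case: VP => _ [VD [VZ _]]; rewrite /B -L2ipP; try exact: V_L2.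
have L : L2 mu (fun w => a * V x w + V y w) := L2D (L2Z a (V_L2 x)) (V_L2 y).
apply: L2ip_ae => //; try exact: V_L2; last by apply: nearW.
by apply: filterS2 (VD (a *: x) y) (VZ a x) => w /= h1 h2 Dw; rewrite h1//= h2.
Qed.

Lemma pullback_le : exists2 C, 0 < C & forall x, B x x <= C * `|x| ^+ 2.
Proof.
(* Adding 1 keeps the constant positive even when [C = 0]. *)
case: VP => _ [_ [_ [[C VC] _]]]; exists (C ^+ 2 + 1) => [|x].
  by rewrite ltr_wpDl ?sqr_ge0.
rewrite /B -L2norm_sq (@le_trans _ _ ((C * `|x|) ^+ 2))//.
  have n0 : 0 <= L2norm mu (V x) by exact: sqrtr_ge0.
  by rewrite ler_pXn2r ?nnegrE ?VC//; exact: le_trans (VC x).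
by rewrite exprMn ler_wpM2r ?sqr_ge0// lerDl.
Qed.

Lemma pullback_ge : exists2 C, 0 < C & forall x, `|x| ^+ 2 <= C * B x x.
Proof.
case: VP => _ [_ [_ [_ [_ [_ [_ [[C VC] _]]]]]]]; exists (C ^+ 2 + 1) => [|x].
  by rewrite ltr_wpDl ?sqr_ge0.
have := VC _ (V_L2 x); rewrite VK /B -L2norm_sq => le1.
rewrite (@le_trans _ _ ((C * L2norm mu (V x)) ^+ 2))//.
  by rewrite ler_pXn2r ?nnegrE//; exact: le_trans le1.
by rewrite exprMn ler_wpM2r ?sqr_ge0// lerDl.
Qed.

(** Writing [y = Vinv (V y)], the adjoint relation moves [Vinv] onto [x], and [VinvT x] is almost
    everywhere [V (Vinv (VinvT x))]. *)
Lemma pullback_adjoint x y : ip x y = B (Vinv (VinvT x)) y.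
Proof.
have [LT TE] := VinvTP x.
rewrite -{1}(VK y) -TE; last exact: V_L2.
apply: L2ip_ae => //; try exact: V_L2; last by apply: nearW.
by apply: filterS (VinvK LT) => w h Dw; rewrite h.
Qed.

Lemma Linfty_ae_bounded : exists M : R, {ae mu, forall w, `|f w| <= M}.
Proof. by case: fP => _ /ess_supr_bounded. Qed.

Lemma mul_f_L2 g : L2 mu g -> L2 mu (fun w => f w * g w).
Proof. by have [M fM] := Linfty_ae_bounded; apply: L2_ae_bounded_mul fM; case: fP. Qed.

Lemma ess_sup_lty : (ess_sup mu (EFin \o f) < +oo)%E.
Proof.
have [_] := fP; apply: le_lt_trans; apply: le_ess_sup; apply: nearW => w.
by rewrite lee_fin ler_norm.
Qed.

Lemma ae_le_esssup : {ae mu, forall w, f w <= esssup mu f}.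
Proof.
have := ess_sup_lty; rewrite /esssup; have := ess_sup_ge mu (EFin \o f).
(* If the essential supremum is [-oo], as for the null measure, [fine] returns 0, but then
   [f w <= -oo] is absurd wherever it is asserted. *)
by case: (ess_sup mu (EFin \o f)) => [r||]// + _; apply: filterS => w.
Qed.

Lemma pullback_A x y : B (A x) y = L2ip mu (fun w => f w * V x w) (V y).
Proof.
have L := mul_f_L2 (V_L2 x); apply: L2ip_ae => //; try exact: V_L2; last by apply: nearW.
by rewrite AP; apply: filterS (VinvK L) => w h Dw; rewrite h.
Qed.

Lemma pullback_A_sym x y : B (A x) y = B x (A y).
Proof.
rewrite [RHS]L2ipC -!/(B _ _) !pullback_A; congr fine; apply: eq_integral => w _.
by congr EFin; ring.
Qed.

Lemma pullback_A_le x : B (A x) x <= esssup mu f * B x x.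
Proof.
rewrite pullback_A; apply: L2ip_mul_le; [by case: fP|exact: V_L2| |exact: ae_le_esssup].
exact: mul_f_L2 (V_L2 x).
Qed.

(** One unit vector [u] tests both norms: [n = |V u|] is at most [|V|], and [V u / n], of norm 1, is
    sent to [u / n], so [1 / n] is at most [|V^-1|]. A nonzero vector is required, since both norms
    vanish on the trivial space. *)
Lemma opnorm_condition_ge1 (x : H) :
  x != 0 -> 1 <= opnormVinv mu Vinv ^+ 2 * opnormV mu V ^+ 2.
Proof.
move=> x0; have nx0 : 0 < `|x| by rewrite normr_gt0.
pose u := `|x|^-1 *: x; have nu : `|u| = 1.
  by rewrite normrZ normfV normr_id mulVf ?gt_eqF.
have BP := pullback_psd.
case: (VP) => _ [_ [_ [[C VC] [_ [_ [VinvZ [[C' VinvC] _]]]]]]].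
set n := L2norm mu (V u).
have n0 : 0 < n.
  rewrite /n sqrtr_gt0 lt_neqAle L2ip_ge0 andbT eq_sym; apply/eqP => u0.
  have [C2 _ /(_ u)] := pullback_ge; rewrite /B u0 mulr0 nu expr1n.
  by rewrite leNgt ltr01.
have n_le : n <= opnormV mu V.
  apply: ub_le_sup; last by exists u => //=; rewrite nu.
  exists `|C| => _ [y /= y1 <-]; rewrite (le_trans (VC y))//.
  by rewrite (le_trans (ler_wpM2r _ (ler_norm C)))// ler_piMr.
have ninv_le : n^-1 <= opnormVinv mu Vinv.
  apply: ub_le_sup.
    exists `|C'| => _ [g /= [Lg g1] <-]; rewrite (le_trans (VinvC g Lg))//.
    by rewrite (le_trans (ler_wpM2r _ (ler_norm C')))// ?sqrtr_ge0// ler_piMr.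
  have Ln := L2Z n^-1 (V_L2 u).
  exists (fun w => n^-1 * V u w) => /=; last first.
    rewrite VinvZ; last exact: V_L2.
    by rewrite VK normrZ nu mulr1 ger0_norm ?invr_ge0 ?ltW.
  split=> //; rewrite -(@ler_pXn2r _ 2)// ?nnegrE ?sqrtr_ge0//.
  rewrite L2norm_sq expr1n.
  rewrite L2ipZ ?[L2ip _ _ (fun w => _ * _)]L2ipC ?L2ipZ//; try exact: V_L2.
  by rewrite -L2norm_sq mulrA -expr2 -exprMn mulVf ?gt_eqF// expr1n.
rewrite -exprMn exprn_ege1//.
have <- : n^-1 * n = 1 by rewrite mulVf ?gt_eqF.
by rewrite ler_pM ?invr_ge0 ?(ltW n0).
Qed.

(** * Spectrum and essential supremum *)

Lemma resolvent_bounded l : bijective (fun x => A x - l *: x) ->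
  exists C, forall x, B x x <= C * B (A x - l *: x) (A x - l *: x).
Proof.
have BP := pullback_psd.
have [C1 C1_gt0 B_le] := pullback_le; have [C2 C2_gt0 B_ge] := pullback_ge.
move=> [T ST TS].
(* [real_spectrum] speaks of bijectivity alone; boundedness of the inverse [T] is recovered from its
   symmetry, inherited from [A - l]. *)
have [|C TC] := @symmetric_bounded _ _ _ _ _ BP C1_gt0 C2_gt0 B_le B_ge T.
  move=> x y; rewrite -{1}(TS y) -{2}(TS x) !(formDl BP, formDr BP, formNl BP, formNr BP).
  by rewrite (formZl BP) (formZr BP) pullback_A_sym.
by exists C => x; rewrite -{1 2}(ST x); exact: TC.
Qed.

(* Approximate eigenvectors: the indicator of [f > l - eps] at [l = esssup f]. *)
Lemma approx_eigenvector eps : (mu setT < +oo)%E -> 0 < esssup mu f -> 0 < eps ->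
  exists x, 0 < B x x /\
    B (A x - esssup mu f *: x) (A x - esssup mu f *: x) <= eps ^+ 2 * B x x.
Proof.
move=> mu_fin l0 eps0; set l := esssup mu f; have [mf _] := fP.
(* Positivity of [l] rules out [-oo], whose [fine] is 0. *)
have lE : ess_sup mu (EFin \o f) = l%:E.
  by move: l0 ess_sup_lty; rewrite /l /esssup; case: (ess_sup _ _) => //=; rewrite ltxx.
pose E := [set w | l - eps < f w].
have mE : measurable E.
  rewrite (_ : E = setT `&` f @^-1` `]l - eps, +oo[%classic).
    exact: mf.
  by rewrite setTI; apply/seteqP; split=> w; rewrite /E /= in_itv/= andbT.
pose g : Omega -> R := \1_E.
have mg : measurable_fun setT g by exact: measurable_indic.
have g2 w : g w * g w = g w by rewrite /g indicE; case: (_ \in _); rewrite ?mulr1 ?mulr0.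
have intg : (\int[mu]_w (g w)%:E = mu E)%E by rewrite integral_indic// setIT.
have muE_fin : (mu E < +oo)%E.
  by apply: le_lt_trans mu_fin; apply: le_measure; rewrite ?inE.
have Lg : L2 mu g.
  split=> //; under eq_integral do rewrite expr2 g2.
  by rewrite intg.
have gg : L2ip mu g g = fine (mu E).
  by rewrite /L2ip; under eq_integral do rewrite g2; rewrite intg.
(* Were [E] null, [l - eps] would be an essential upper bound below [l]. *)
have muE0 : (0 < mu E)%E.
  rewrite lt_neqAle measure_ge0 andbT eq_sym; apply/eqP => E0.
  have : (ess_sup mu (EFin \o f) <= (l - eps)%:E)%E.
    apply/ess_supP; exists E; split=> // w /= /negP; rewrite lee_fin -ltNge.
    by [].
  by rewrite lE lee_fin leNgt ltrBlDr ltrDl eps0.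
pose x := Vinv g; have Vx : V x = g %[ae mu] by exact: VinvK.
have Bxx : B x x = fine (mu E).
  by rewrite -gg; apply: L2ip_ae => //; exact: V_L2.
exists x; split; first by rewrite Bxx fine_gt0// muE0.
(* [(A - l) x] is represented by [(f - l) g], whose squared norm is the integral of [h g g] because
   [g^2 = g]. The factor [g] in [h] restricts to [E], where [l - eps < f <= l] almost everywhere. *)
pose h w := (f w - l) ^+ 2 * g w.
have mh : measurable_fun setT h.
  by apply: measurable_funM => //; apply: measurable_funX; exact: measurable_funB.
have h_le : {ae mu, forall w, h w <= eps ^+ 2}.
  apply: filterS (ae_le_esssup) => w fl; rewrite /h /g indicE.
  case: (boolP (w \in E)) => [|_]; last by rewrite mulr0 sqr_ge0.
  rewrite inE /E /= mulr1 => fl'; rewrite -/l in fl; nra.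
have h_norm : {ae mu, forall w, `|h w| <= eps ^+ 2}.
  apply: filterS h_le => w; rewrite ger0_norm//.
  by rewrite mulr_ge0 ?sqr_ge0// -g2 -expr2 sqr_ge0.
have Lh := L2_ae_bounded_mul mh h_norm Lg.
rewrite Bxx -gg (le_trans _ (L2ip_mul_le mh Lg Lh h_le))//.
have Lk : L2 mu (fun w => f w * g w + (- l) * g w) := L2D (mul_f_L2 Lg) (L2Z (- l) Lg).
have Vk : V (A x - l *: x) = (fun w => f w * g w + (- l) * g w) %[ae mu].
  case: VP => _ [VD [VZ _]].
  have VA := VinvK (mul_f_L2 (V_L2 x)); rewrite -AP in VA.
  rewrite -scaleNr; apply: filterS2 (filterI (VD (A x) ((- l) *: x)) (VZ (- l) x)) (filterI VA Vx).
  by move=> w [h1 h2] [h3 h4] Dw; rewrite h1//= h2//= h3//= h4.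
rewrite le_eqVlt; apply/orP; left; apply/eqP.
rewrite /B (L2ip_ae _ _ _ _ Vk Vk)//; try exact: V_L2.
congr fine; apply: eq_integral => w _; congr EFin; rewrite /h.
have -> : (f w - l) ^+ 2 * g w * g w * g w = (f w - l) ^+ 2 * g w * (g w * g w) by ring.
rewrite g2 -mulrA g2; transitivity ((f w - l) ^+ 2 * (g w * g w)); first by ring.
by rewrite g2.
Qed.

Lemma esssup_le0 : (mu setT < +oo)%E -> real_spectrum A `<=` [set l | l <= 0] ->
  esssup mu f <= 0.
Proof.
move=> mu_fin specA; rewrite leNgt; apply/negP => l0.
have /contrapT/resolvent_bounded[C BC] : ~ ~ bijective (fun x => A x - esssup mu f *: x).
  by move=> /specA /=; rewrite leNgt l0.
have c0 : 0 < `|C| + 1 by rewrite ltr_wpDl.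
(* With [eps = 1 / (|C| + 1)] one has [|C| eps^2 < 1], so the two bounds together give
   [B x x < B x x]. *)
have ci0 : 0 < (`|C| + 1)^-1 by rewrite invr_gt0.
have [x [x0]] := approx_eigenvector mu_fin l0 ci0.
set b := B (_ - _) _ => b_le.
have b0 : 0 <= b by exact: form_ge0 pullback_psd _.
have : B x x <= `|C| * ((`|C| + 1)^-1 ^+ 2 * B x x).
  rewrite (le_trans (BC x))// (le_trans (ler_wpM2r b0 (ler_norm C)))//.
  by rewrite ler_wpM2l.
rewrite leNgt => /negP; apply.
rewrite mulrA gtr_pMl// exprVn ltr_pdivrMr ?exprn_gt0// mul1r.
have := normr_ge0 C; nra.
Qed.

End Diagonalisable.

Theorem theorem2 (R : realType) (H : completeNormedModType R) (ip : H -> H -> R)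
  (d : measure_display) (Omega : measurableType d) (mu : {measure set Omega -> \bar R})
  (f : Omega -> R) (V : H -> Omega -> R) (Vinv : (Omega -> R) -> H)
  (VinvT : H -> Omega -> R) (A : H -> H) :
  is_inner_product ip -> separable H ->
  Linfty mu f ->
  inv_bounded_linear mu V Vinv ->
  is_adjoint_of_inv mu ip Vinv VinvT ->
  (forall x, A x = Vinv (fun w => f w * V x w)) ->
  (forall y, exists x, A x = y) ->
  let F := fun x => - (1 / 2) * L2ip mu (V x) (fun w => f w * V x w) in
  let K := fun xi => Vinv (VinvT xi) in
  let cV := if 0 <= esssup mu f
            then opnormVinv mu Vinv ^+ 2 * opnormV mu V ^+ 2
            else (opnormVinv mu Vinv ^+ 2 * opnormV mu V ^+ 2)^-1 in
  let lam := - esssup mu f * cV in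
  geod_convex ip K F lam /\
  ((mu setT < +oo)%E -> real_spectrum A `<=` [set l | l <= 0] ->
     {ae mu, forall w, f w <= 0} /\ 0 <= lam).
Proof.
move=> ipP _ fP VP VinvTP AP _ F K cV lam; split.
  have -> : F = fun x => - (1 / 2) * L2ip mu (V x) (V (A x)).
    by apply/funext => x; rewrite /F L2ipC -(pullback_A fP VP AP) L2ipC.
  have [C1 C1_gt0 B_le] := pullback_le VP; have [C2 C2_gt0 B_ge] := pullback_ge VP.
  have BP := pullback_psd VP.
  apply: (cs_geodesic_form_convex lam ipP BP C1_gt0 C2_gt0 B_le B_ge
    (pullback_adjoint VP VinvTP) (pullback_A_sym fP VP AP)) => x.
  rewrite (le_trans (pullback_A_le fP VP AP x))//.
  have -> : - lam = esssup mu f * cV by rewrite /lam mulNr opprK.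
  have [->|x0] := eqVneq x 0; first by rewrite (form0l BP) !mulr0.
  (* A nonnegative essential supremum grows under a factor at least 1, a negative one under the
     inverse factor, at most 1. *)
  have p1 := opnorm_condition_ge1 VP x0.
  rewrite ler_wpM2r ?(form_ge0 BP)// /cV; case: ifPn => [S0|S0].
    by rewrite ler_peMr.
  by rewrite ler_niMr ?invf_le1 ?(lt_le_trans ltr01 p1)// ltW// ltNge.
move=> mu_fin specA; have S0 := esssup_le0 fP VP AP mu_fin specA; split.
  by apply: filterS (ae_le_esssup fP) => w; move/le_trans; apply.
rewrite /lam mulr_ge0 ?oppr_ge0// /cV; case: ifP => _.
  by rewrite mulr_ge0 ?sqr_ge0.
by rewrite invr_ge0 mulr_ge0 ?sqr_ge0.
Qed.
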